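(* Let $N_0>1$, $1<b<2$, $\nu>0$, $N_n=N_0^{b^n}$ for $n\ge0$, and $\alpha_c=\frac1{b+2}$. Let $0\le\alpha<\alpha_c$. For every $s>\alpha_c$ there exist a non-negative finitely supported initial datum $h$ and a time $T_R<\infty$ such that every global non-negative finite-energy solution $u$ of $$\dot u_n+\nu N_n^{2\alpha}u_n=N_{n-1}u_{n-1}^2-N_nu_nu_{n+1}\quad(n\ge0),\qquad u_n(0)=h_n$$ (incoming term equal to $0$ for $n=0$) satisfies $$\sup_{0\le t\le T_R}\|u(t)\|_{H_N^s}=\infty.$$ In particular, the corresponding smooth solution has maximal smooth existence time $T_{\max}\le T_R<\infty$. (The datum $h$ and $T_R$ may depend on $s$ and on the fixed parameters $N_0,b,\nu,\alpha$.)
   Context: For $s\in\mathbb R$, $\|u\|_{H_N^s}^2=\sum_{n\ge0}N_n^{2s}|u_n|^2$ (possibly $+\infty$), and $H_N^\infty$ is the set of sequences with $\|u\|_{H^s_N}<\infty$ for all $s>0$. ''Non-negative'' means all coordinates are $\ge0$ (at all times, for a solution). A finite-energy solution on an interval $I\subset[0,\infty)$ is an $\ell^2$-valued map $u$ on $I$ whose coordinates $u_n$ belong to $C^1(I)$ and satisfy the equations for every $n\ge0$ (one-sided derivatives at included endpoints), with $u_n(0)=h_n$ for all $n$ if $0\in I$; it is global if $I=[0,\infty)$. It is smooth on $I$ if $\sup_{t\in J}\|u(t)\|_{H_N^s}<\infty$ for every compact interval $J\subset I$ and every $s>0$. For non-negative $h\in H_N^\infty$ there is a local non-negative smooth solution,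 and non-negative smooth solutions on a common interval with the same datum coincide; the maximal smooth existence time $T_{\max}\in(0,\infty]$ is the supremum of the $T>0$ for which a non-negative smooth solution with datum $h$ exists on $[0,T)$. *)

(* Defs.v *)
From HB Require Import structures.
From mathcomp Require Import all_boot all_order all_algebra.
From mathcomp Require Import all_classical all_reals all_analysis.

Set Implicit Arguments.
Unset Strict Implicit.
Unset Printing Implicit Defensive.

Import Order.TTheory GRing.Theory Num.Theory.
Import numFieldNormedType.Exports.

Local Open Scope classical_set_scope.
Local Open Scope ring_scope.

Section ShellModel.
Context {R : realType}.

Definition freq (N0 b : R) (n : nat) : R := N0 `^ (b ^+ n).

Definition alphac (b : R) : R := (b + 2)^-1.

Definition HN_norm (N : nat -> R) (s : R) (a : nat -> R) : \bar R :=
  sqrte (\sum_(0 <= n <oo) (N n `^ (2 * s) * `|a n| ^+ 2)%:E)%E.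

Definition in_l2 (a : nat -> R) : Prop :=
  (\sum_(0 <= n <oo) (`|a n| ^+ 2)%:E < +oo)%E.

Definition finitely_supported (a : nat -> R) : Prop :=
  exists m, forall n, (m <= n)%N -> a n = 0.

Definition nonneg_seq (a : nat -> R) : Prop := forall n, 0 <= a n.

(* The difference quotient only uses points of I, so the derivative is
   one-sided at an endpoint that belongs to I. *)
Definition deriv_on (I : interval R) (f df : R -> R) : Prop :=
  forall t, t \in I ->
    (f r - f t) / (r - t) @[r --> within [set` I] t^'] --> df t.

(* Values of u outside I are unconstrained; I is meant to be a nondegenerate
   subinterval of [0, +oo[. *)
Definition finite_energy_solution (N : nat -> R) (nu alpha : R) (h : nat -> R)
    (I : interval R) (u : R -> nat -> R) : Prop :=
  [/\ forall t, t \in I -> in_l2 (u t),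
      forall n, exists du : R -> R,
        [/\ deriv_on I (u^~ n) du,
            {within [set` I], continuous du} &
            forall t, t \in I ->
              du t + nu * N n `^ (2 * alpha) * u t n
              = (if n is m.+1 then N m * u t m ^+ 2 else 0)
                - N n * u t n * u t n.+1] &
      0 \in I -> forall n, u 0 n = h n].

Definition nonneg_on (I : interval R) (u : R -> nat -> R) : Prop :=
  forall t, t \in I -> nonneg_seq (u t).

Definition HN_sup (N : nat -> R) (s a c : R) (u : R -> nat -> R) : \bar R :=
  ereal_sup [set HN_norm N s (u t) | t in `[a, c]].

Definition smooth_on (N : nat -> R) (I : interval R) (u : R -> nat -> R) : Prop :=
  forall a c : R, `[a, c] `<=` [set` I] ->
  forall s : R, 0 < s -> (HN_sup N s a c u < +oo)%E.

Definition Tmax (N : nat -> R) (nu alpha : R) (h : nat -> R) : \bar R :=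
  ereal_sup [set T%:E | T in [set T : R | 0 < T /\ exists u : R -> nat -> R,
    [/\ finite_energy_solution N nu alpha h `[0, T[ u,
        nonneg_on `[0, T[ u & smooth_on N `[0, T[ u]]].

End ShellModel.

(* Main.v *)
Require Import Defs.
From HB Require Import structures.
From mathcomp Require Import all_boot all_order all_algebra.
From mathcomp Require Import all_classical all_reals all_analysis.
From mathcomp Require Import ring lra.
Import Order.TTheory GRing.Theory Num.Theory.
Import numFieldNormedType.Exports.
Local Open Scope classical_set_scope.
Local Open Scope ring_scope.

(* Test the equation against the weights lam n = N n `^ p with p slightly larger
   than - alphac b, truncated to m <= n <= m + k, and put L = sum lam n * u n.
   For p > - alphac b and m large the transfer terms are absorbed by
   Q = sum lam n.+1 * N n * u n ^ 2, and the dissipation is a small fraction of Q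
   up to a constant because alpha < alphac b.  A bound on the H^s norm with
   s > alphac b makes the flux through the truncation at most 1 for k large, so
   that L' >= c L^2 - C with c and C independent of that bound.  If L 0 is large,
   which a single excited mode achieves, L cannot exist up to time 1. *)

(** * Choice of the weight exponent *)

(** Since [(b + 2) * alphac b = 1], all four become equalities at [p = - alphac b] and
    [alpha = s = alphac b]; the two strict gaps leave room to raise [p] slightly. In order, they
    give lacunarity, summability of the dissipation weights, and decay of the two flux terms at the
    truncation. *)
Lemma exponent_choice (R : realType) (b alpha s : R) :
  1 < b -> b < 2 -> alpha < alphac b -> alphac b < s ->
  exists p : R, [/\ 0 < 1 + (b + 2) * p, p * (2 - b) + 4 * alpha < 1,
                    1 + b * p < 2 * s & 1 + p < (b + 1) * s].
Proof.
move=> b1 b2 al ls; set ac := alphac b in al ls *.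
have acE : (b + 2) * ac = 1 by rewrite /ac /alphac mulfV// gt_eqF//; lra.
pose d := Num.min (ac - alpha) (s - ac).
have d0 : 0 < d by rewrite lt_min !subr_gt0 al.
have d1 : d <= ac - alpha by rewrite ge_min lexx.
have d2 : d <= s - ac by rewrite ge_min lexx orbT.
exists (d - ac); split; nra.
Qed.

(** * Calculus with one-sided derivatives *)

Lemma deriv_on_cvg (R : realType) (I : interval R) (f df : R -> R) (t : R) :
  deriv_on I f df -> t \in I -> f r @[r --> within [set` I] t^'] --> f t.
Proof.
move=> fdf tI; have tid : r @[r --> within [set` I] t^'] --> t.
  by apply: (cvg_trans (cvg_within _)); exact: cvg_within.
have -> : f t = df t * (t - t) + f t by rewrite subrr mulr0 add0r.
have : ((f r - f t) / (r - t)) * (r - t) + f t @[r --> within [set` I] t^']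
       --> df t * (t - t) + f t.
  apply: cvgD; last exact: cvg_cst.
  by apply: cvgM; [exact: fdf|apply: cvgB => //; exact: cvg_cst].
apply: cvg_trans; apply: near_eq_cvg.
rewrite near_withinE /=; apply/nbhs_ballP; exists 1 => //= r _ rt _.
by rewrite divfK ?subr_eq0// addrNK.
Qed.

Lemma deriv_on_within_continuous (R : realType) (I : interval R)
    (f df : R -> R) :
  deriv_on I f df -> {within [set` I], continuous f}.
Proof.
move=> fdf; apply/subspace_continuousP => t tI; apply/cvgrPdist_lt => e e0.
have /cvgrPdist_lt/(_ e e0) := deriv_on_cvg _ _ _ _ _ fdf tI.
rewrite !near_withinE => /= /nbhs_ballP[r r0 rf].
apply/nbhs_ballP; exists r => //= y yt yI.
have [->|ynt] := eqVneq y t; first by rewrite subrr normr0.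
exact: rf.
Qed.

(** Near an interior point every increment stays in [I], so the restricted quotient is the ordinary
    one; the mean value theorem asks for no more. *)
Lemma deriv_on_is_derive (R : realType) (I : interval R) (f df : R -> R)
    (a c t : R) :
  deriv_on I f df -> `[a, c] `<=` [set` I] -> t \in `]a, c[ ->
  is_derive t 1 f (df t).
Proof.
move=> fdf acI tac; have tI : t \in I.
  by apply: acI; apply: (subset_itv_oo_cc) => /=.
suff H : (h^-1 *: ((f \o shift t) (h *: (1 : R)) - f t) @[h --> (0 : R)^'])
    --> df t.
  by apply: DeriveDef; [apply/cvg_ex; exists (df t)|exact: cvg_lim].
apply/cvgrPdist_lt => e e0.
have /cvgrPdist_lt/(_ e e0) := fdf t tI.
rewrite near_withinE => /= /nbhs_ballP[r r0 rf].
have /nbhs_ballP[r' r'0 r'I] := near_in_itvoo tac.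
near=> h; rewrite /= /GRing.scale /= mulr1.
have h0 : h != 0 by near: h; exact: nbhs_dnbhs_neq.
have hr : `|h| < Num.min r r' by near: h; apply: dnbhs0_lt; rewrite lt_min r0.
have := rf (h + t); rewrite addrK mulrC; apply.
- rewrite /ball /= opprD addrCA subrr addr0 normrN.
  by rewrite (lt_le_trans hr)// ge_min lexx.
- by rewrite -subr_eq0 addrK.
- apply: acI; apply: subset_itv_oo_cc => /=; apply: r'I.
  rewrite /ball /= opprD addrCA subrr addr0 normrN.
  by rewrite (lt_le_trans hr)// ge_min lexx orbT.
Unshelve. all: by end_near. Qed.

(** * Finite-time blow-up for a Riccati inequality *)

(** From [df >= - C] and [2 * C <= f 0], [f] never drops below half its initial value. There
    [c * f ^ 2] is at least [2 * C], so [df >= c / 2 * f ^ 2] and [1 / f] falls at rate at least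
    [c / 2]. It starts at most at [c / 2], hence is not positive at time 1. *)
Lemma riccati_blowup (R : realType) (c C : R) (f df : R -> R) :
  {within `[0, 1], continuous f} ->
  (forall t : R, t \in `]0, 1[ -> is_derive t 1 f (df t)) ->
  (forall t : R, t \in `]0, 1[ -> c * f t ^+ 2 - C <= df t) ->
  0 < c -> 0 <= C -> 0 < f 0 -> 2 * C <= f 0 -> 8 * C <= c * f 0 ^+ 2 ->
  2 <= c * f 0 -> False.
Proof.
move=> fc fd fdge c0 C0 f0 f0C f0C2 f0c.
have fge t : t \in `[0, 1] -> f 0 / 2 <= f t.
  rewrite in_itv /= le_eqVlt => /andP[/predU1P[<- _|t0 t1]]; first by lra.
  have sub x : x \in `]0, t[ -> x \in `]0, 1[.
    by rewrite !in_itv /= => /andP[-> /lt_le_trans ->].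
  have [|||x xt E] := @MVT R f df 0 t.
  - by [].
  - by move=> x /sub; exact: fd.
  - apply: continuous_subspaceW fc => x /=; rewrite !in_itv /= => /andP[-> xt].
    exact: le_trans xt t1.
  - have := fdge x (sub x xt); have := sqr_ge0 (f x).
    move: E; rewrite subr0 => E; move: (f x ^+ 2) => z z0 Hz.
    have : - C <= df x by nra.
    nra.
have fgt t : t \in `[0, 1] -> 0 < f t by move=> /fge; apply: lt_le_trans; lra.
have [|||x x01] := @MVT R (fun t : R => (f t)^-1) (fun t : R => - (f t) ^- 2 *: df t) 0 1.
- by [].
- move=> t t01; apply: is_deriveV; last exact: fd.
  by rewrite gt_eqF//; apply: fgt; exact: subset_itv_oo_cc t01.
- apply/subspace_continuousP => t t01; apply: cvgV.
    by rewrite gt_eqF// fgt.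
  by move/subspace_continuousP : fc; exact.
rewrite subr0 mulr1 /GRing.scale /= => E.
have fx : 0 < f x by apply: fgt; exact: subset_itv_oo_cc x01.
have fx2 : f 0 / 2 <= f x by apply: fge; exact: subset_itv_oo_cc x01.
have f1 : 0 < (f 1)^-1 by rewrite invr_gt0 fgt// in_itv/= ler01 lexx.
have : c / 2 <= f x ^- 2 * df x.
  rewrite [leRHS]mulrC ler_pdivlMr ?exprn_gt0//.
  apply: le_trans (fdge x x01).
  have : c * (f 0 / 2) ^+ 2 <= c * f x ^+ 2.
    by rewrite ler_wpM2l ?(ltW c0)// ler_sqr// nnegrE ltW// divr_gt0.
  by rewrite expr_div_n; lra.
have : (f 0)^-1 <= c / 2.
  by rewrite -[_^-1]mul1r ler_pdivrMr//; lra.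
by move: E; rewrite mulNr; lra.
Qed.

(** * Weighted balance of the nonlinear transfer *)

(** The arithmetic-geometric mean inequality for [a * u ^ 2] and [a' * v ^ 2], proved by comparing
    squares so that no root of [a * a'] appears. *)
Lemma prod_le_sqrD (R : realType) (a a' c u v : R) :
  0 <= a -> 0 <= a' -> 0 <= u -> 0 <= v -> 4 * c ^+ 2 <= a * a' ->
  4 * (c * u * v) <= a * u ^+ 2 + a' * v ^+ 2.
Proof.
move=> a0 a'0 u0 v0 H.
have [c0|c0] := lerP c 0.
  by have := mulr_ge0 u0 v0; have := mulr_ge0 a0 (sqr_ge0 u);
     have := mulr_ge0 a'0 (sqr_ge0 v); nra.
rewrite -ler_sqr ?nnegrE; last 2 first.
- by rewrite !mulr_ge0// ltW.
- by rewrite addr_ge0// mulr_ge0// sqr_ge0.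
have := sqr_ge0 (a * u ^+ 2 - a' * v ^+ 2).
have : 0 <= u ^+ 2 * v ^+ 2 by rewrite mulr_ge0// sqr_ge0.
by move: (ler_wpM2r (mulr_ge0 (sqr_ge0 u) (sqr_ge0 v)) H); nra.
Qed.

Definition net_flux (R : realType) (N v : nat -> R) (n : nat) : R :=
  (if n is m.+1 then N m * v m ^+ 2 else 0) - N n * v n * v n.+1.

Section WeightedFlux.
Variables (R : realType) (N lam v : nat -> R) (m : nat).
Hypothesis N_gt0 : forall n, 0 < N n.
Hypothesis lam_gt0 : forall n, 0 < lam n.
Hypothesis v_ge0 : forall n, 0 <= v n.
(** The coefficient with which [v n ^ 2] enters the weighted sum, as the incoming term of shell
    [n.+1]. *)
Let a n := lam n.+1 * N n.
Hypothesis lacunary :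
  forall n, (m <= n)%N -> 4 * (lam n * N n) ^+ 2 <= a n * a n.+1.

Let a_gt0 n : 0 < a n. Proof. by rewrite mulr_gt0. Qed.

(* The last two terms are the flux through the truncation: once they are added,
   each transfer term [lam n * N n * v n * v n.+1] is absorbed by the two
   neighbouring squares. *)
Lemma weighted_flux_ge (k : nat) :
  2^-1 * (\sum_(i < k.+1) a (m + i)%N * v (m + i)%N ^+ 2)
    + 4^-1 * (a (m + k)%N * v (m + k)%N ^+ 2) <=
  \sum_(i < k.+1) lam (m + i)%N * net_flux R N v (m + i)%N
    + a (m + k)%N * v (m + k)%N ^+ 2
    + lam (m + k)%N * N (m + k)%N * v (m + k)%N * v (m + k).+1.
Proof.
elim: k => [|k IH].
  rewrite !big_ord_recl !big_ord0 !addr0 addn0 /=.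
  set j := m.
  (* What enters from below shell [m] is nonnegative and can be discarded. *)
  have fl : - (lam j * N j * v j * v j.+1) <= lam j * net_flux R N v j.
    rewrite /net_flux mulrBr !mulrA lerDr mulr_ge0 ?(ltW (lam_gt0 _))//.
    by case: j => // j; rewrite mulr_ge0 ?sqr_ge0// ltW.
  by have := mulr_ge0 (ltW (a_gt0 j)) (sqr_ge0 (v j)); lra.
rewrite big_ord_recr [X in _ <= X + _ + _]big_ord_recr/= addnS {2}/net_flux.
move: IH; set j := (m + k)%N; set Q := \sum_(i < k.+1) _.
set S := \sum_(i < k.+1) _ => IH.
have -> : lam j.+1 * (N j * v j ^+ 2 - N j.+1 * v j.+1 * v j.+2) =
    a j * v j ^+ 2 - lam j.+1 * N j.+1 * v j.+1 * v j.+2.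
  by rewrite /a; ring.
(* The spare quarter kept in the induction hypothesis, with a quarter of the new square, pays for
   the transfer from [j] to [j.+1]. *)
have := prod_le_sqrD _ _ _ _ _ _ (ltW (a_gt0 j)) (ltW (a_gt0 j.+1))
  (v_ge0 j) (v_ge0 j.+1) (lacunary j (leq_addr _ _)).
have := mulr_ge0 (ltW (a_gt0 j)) (sqr_ge0 (v j)).
have := mulr_ge0 (ltW (a_gt0 j.+1)) (sqr_ge0 (v j.+1)).
by lra.
Qed.

(* Completing the square in [y * lam n * v n], where [y] is free. *)
Lemma weighted_sum_le (k : nat) (mu : nat -> R) (y : R) :
  y * (\sum_(i < k) mu (m + i)%N * v (m + i)%N) <=
  \sum_(i < k) a (m + i)%N * v (m + i)%N ^+ 2 +
  y ^+ 2 / 4 * \sum_(i < k) mu (m + i)%N ^+ 2 / a (m + i)%N.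
Proof.
rewrite !mulr_sumr -big_split /=; apply: ler_sum => i _.
move: (m + i)%N => n; rewrite -subr_ge0.
set x := mu n; set w := v n; have a0 := a_gt0 n; set e := a n in a0 *.
have -> : e * w ^+ 2 + y ^+ 2 / 4 * (x ^+ 2 / e) - y * (x * w) =
    (e * w - y * x / 2) ^+ 2 / e by field; rewrite gt_eqF.
by rewrite divr_ge0 ?sqr_ge0// ltW.
Qed.

End WeightedFlux.

(** * Growth of the frequencies *)

Section Frequencies.
Variables (R : realType) (N0 b : R).
Hypotheses (N0_gt1 : 1 < N0) (b_gt1 : 1 < b).
Local Notation N := (freq N0 b).

Let N0_gt0 : 0 < N0. Proof. exact: lt_trans N0_gt1. Qed.
Let b_gt0 : 0 < b. Proof. exact: lt_trans b_gt1. Qed.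

Lemma freq_gt0 n : 0 < N n. Proof. exact: powR_gt0. Qed.

Lemma freqS n : N n.+1 = N n `^ b.
Proof. by rewrite /freq -powRrM -exprSr. Qed.

Lemma freq_ge1 n : 1 <= N n.
Proof.
by rewrite -(powRr0 N0) ler_powR ?exprn_ge0// ltW.
Qed.

Lemma freqM n (x y : R) : N n `^ (x + y) = N n `^ x * N n `^ y.
Proof. by rewrite powRD// (gt_eqF (freq_gt0 n)) implybT. Qed.

(** Bernoulli's inequality [n * (b - 1) <= b ^ n] turns the doubly exponential decay into a
    geometric one. *)
Lemma freq_decay (e : R) : 0 < e ->
  exists2 q : R, 0 < q < 1 & forall n, N n `^ (- e) <= q ^+ n.
Proof.
move=> e0; have e1 : 0 < e * (b - 1) by rewrite mulr_gt0// subr_gt0.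
exists (N0 `^ (- (e * (b - 1)))).
  have : 1 `^ (e * (b - 1)) < N0 `^ (e * (b - 1)).
    by apply: gt0_ltr_powR; rewrite ?nnegrE ?ltW.
  by rewrite powR1 powR_gt0//= powRN => ?; rewrite invf_lt1 ?powR_gt0.
move=> n; rewrite -powR_mulrn ?powR_ge0// /freq -!powRrM ler_powR ?(ltW N0_gt1)//.
have bern : n%:R * (b - 1) <= b ^+ n.
  elim: n => [|n IH]; first by rewrite mul0r.
  rewrite exprS -natr1; have := exprn_ege1 n (ltW b_gt1); rewrite -subr_ge0.
  have b0 : 0 <= b - 1 by rewrite subr_ge0 ltW.
  by move/(mulr_ge0 b0); lra.
by have := ler_wpM2l (ltW e0) bern; lra.
Qed.

Lemma freq_small (e : R) (eps : R) : 0 < e -> 0 < eps ->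
  exists m, forall n, (m <= n)%N -> N n `^ (- e) <= eps.
Proof.
move=> /freq_decay[q /andP[q0 q1] Nq] eps0.
have : q ^+ n @[n --> \oo] --> 0 by apply: cvg_expr; rewrite ger0_norm// ltW.
move/cvgrPdist_le => /(_ eps eps0)[m _ mq].
exists m => n mn; apply: (le_trans (Nq n)).
by have := mq n mn; rewrite /= sub0r normrN ger0_norm ?exprn_ge0// ltW.
Qed.

(** One geometric series dominates the sum for every start and length, so constants built from [D]
    do not depend on the truncation. *)
Lemma freq_sum_bounded (e : R) : 0 < e ->
  exists2 D : R, 0 < D &
    forall m k, \sum_(i < k) N (m + i)%N `^ (- e) <= D.
Proof.
move=> /freq_decay[q /andP[q0 q1] Nq]; exists (1 - q)^-1.
  by rewrite invr_gt0 subr_gt0.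
move=> m k; apply: (@le_trans _ _ (\sum_(i < k) q ^+ i)).
  apply: ler_sum => i _; apply: (le_trans (Nq _)).
  by rewrite exprD ler_piMl ?exprn_ge0 ?exprn_ile1// ltW.
rewrite -[leRHS]mul1r ler_pdivlMr ?subr_gt0// mulrC.
by rewrite -opprB mulNr -subrX1 opprB gerBl exprn_ge0// ltW.
Qed.

End Frequencies.

(** * Coordinate bounds and finite linear combinations *)

Lemma HN_norm_coord (R : realType) (N : nat -> R) (s K : R) (v : nat -> R) n :
  0 <= K -> (HN_norm N s v <= K%:E)%E -> N n `^ s * `|v n| <= K.
Proof.
move=> K0 vK; rewrite -ler_sqr ?nnegrE ?mulr_ge0 ?powR_ge0//.
have -> : (N n `^ s * `|v n|) ^+ 2 = N n `^ (2 * s) * `|v n| ^+ 2.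
  by rewrite exprMn -powR_mulrn ?powR_ge0// -powRrM [s * _]mulrC.
rewrite -lee_fin; set F := fun n => (N n `^ (2 * s) * `|v n| ^+ 2)%:E.
have F0 i : (0 <= F i)%E by rewrite lee_fin mulr_ge0 ?powR_ge0// sqr_ge0.
have le1 : (F n <= \sum_(0 <= i <oo) F i)%E.
  apply: le_trans (@nneseries_lim_ge R F predT 0 n.+1 (fun i _ _ => F0 i)).
  by rewrite big_nat_recr//= leeDr// sume_ge0.
apply: (le_trans le1).
rewrite -lee_sqrt ?lee_fin ?sqr_ge0// EFin_expe sqrte_sqr gee0_abs ?lee_fin//.
Qed.

Lemma deriv_on_lincomb (R : realType) (I : interval R) (w : nat -> R)
    (f df : nat -> R -> R) (k : nat) :
  (forall n, deriv_on I (f n) (df n)) ->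
  deriv_on I (fun t => \sum_(i < k) w i * f i t)
             (fun t => \sum_(i < k) w i * df i t).
Proof.
move=> fdf t tI.
have -> : (fun r => (\sum_(i < k) w i * f i r - \sum_(i < k) w i * f i t) / (r - t))
    = (fun r => \sum_(i < k) w i * ((f i r - f i t) / (r - t))).
  apply/funext => r; rewrite -sumrB mulr_suml; apply: eq_bigr => i _.
  by rewrite -mulrBr mulrA.
pose q i r := w i * ((f i r - f i t) / (r - t)).
elim: k => [|k IH].
  have -> : (fun r => \sum_(i < 0) q i r) = cst 0.
    by apply/funext => r; rewrite big_ord0.
  by rewrite big_ord0; exact: cvg_cst.
have -> : (fun r => \sum_(i < k.+1) q i r) = (fun r => \sum_(i < k) q i r) \+ q k.
  by apply/funext => r; rewrite big_ord_recr.
rewrite big_ord_recr /=.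
by apply: cvgD IH _; apply: cvgM; [exact: cvg_cst|exact: fdf].
Qed.

Lemma HN_sup_coord (R : realType) (N : nat -> R) (s a c : R)
    (u : R -> nat -> R) :
  HN_sup N s a c u != +oo%E ->
  exists2 K : R, 0 <= K & forall t, t \in `[a, c] -> forall n,
    N n `^ s * `|u t n| <= K.
Proof.
move=> supfin; have [K0 K0ge supK] :
    exists2 K : R, 0 <= K & (HN_sup N s a c u <= K%:E)%E.
  case: (HN_sup N s a c u) supfin => [r|//|] _.
    by exists (Num.max r 0); rewrite ?lee_fin le_max lexx ?orbT.
  (* The supremum is [-oo] when the interval is empty. *)
  by exists 0; rewrite ?leNye.
exists K0 => // t tac n; apply: HN_norm_coord => //.
by apply: le_trans supK; apply: ereal_sup_ubound; exists t.
Qed.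

(** * Construction of the datum and blow-up argument *)

(** A large enough datum allows the time to be normalised to 1. Leaving [I] free lets the same datum
    serve global solutions and smooth solutions on [[0, T[] with [T > 1]. *)
Lemma norm_inflation_datum (R : realType) (N0 b nu alpha s : R) :
  1 < N0 -> 1 < b -> b < 2 -> 0 < nu -> 0 <= alpha -> alpha < alphac b ->
  alphac b < s ->
  exists h : nat -> R, [/\ nonneg_seq h, finitely_supported h &
    forall (I : interval R) (u : R -> nat -> R), `[0, 1] `<=` [set` I] ->
      finite_energy_solution (freq N0 b) nu alpha h I u -> nonneg_on I u ->
      HN_sup (freq N0 b) s 0 1 u = +oo%E].
Proof.
move=> N0gt1 b1 b2 nu0 al0 alc acs.
have [p [p1 p2 p3 p4]] := exponent_choice _ _ _ _ b1 b2 alc acs.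
set N := freq N0 b; pose lam n := N n `^ p; pose a n := lam n.+1 * N n.
have Ngt0 n : 0 < N n by exact: freq_gt0.
have lamgt0 n : 0 < lam n by exact: powR_gt0.
have agt0 n : 0 < a n by rewrite mulr_gt0.
have NM := freqM R N0 b N0gt1.
have NE n : N n = N n `^ 1 by rewrite powRr1// ltW.
have NS n x : N n.+1 `^ x = N n `^ (b * x) by rewrite /N freqS powRrM.
have aE n : a n = N n `^ (1 + b * p) by rewrite /a /lam NS {2}NE -NM addrC.
have [m lac] : exists m, forall n, (m <= n)%N ->
    4 * (lam n * N n) ^+ 2 <= a n * a n.+1.
  have [||m Hm] := freq_small R N0 b N0gt1 b1 ((b - 1) * (1 + (b + 2) * p)) 4^-1.
  - by rewrite mulr_gt0// subr_gt0.
  - by rewrite invr_gt0.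
  exists m => n /Hm H; rewrite !aE NS -NM -ler_pdivlMl// [leRHS]mulrC.
  have -> : (lam n * N n) ^+ 2 =
      N n `^ (1 + b * p + b * (1 + b * p)) *
      N n `^ (- ((b - 1) * (1 + (b + 2) * p))).
    rewrite /lam {2}NE -NM expr2 -!NM; congr (_ `^ _); ring.
  by rewrite ler_wpM2l// powR_ge0.
have [|D D0 sumD] := freq_sum_bounded R N0 b N0gt1 b1 (1 - p * (2 - b) - 4 * alpha).
  lra.
have dragE n : (lam n * N n `^ (2 * alpha)) ^+ 2 / a n =
    N n `^ (- (1 - p * (2 - b) - 4 * alpha)).
  rewrite aE -powRN /lam -NM expr2 -!NM; congr (_ `^ _); ring.
have dragD k : \sum_(i < k) (lam (m + i)%N * N (m + i)%N `^ (2 * alpha)) ^+ 2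
    / a (m + i)%N <= D.
  by apply: le_trans (sumD m k); apply: ler_sum => i _; rewrite dragE.
(* These are the dissipation weights with [alpha] replaced by 0; as [alpha >= 0], the same [D]
   bounds them. *)
have massD k : \sum_(i < k) lam (m + i)%N ^+ 2 / a (m + i)%N <= D.
  apply: le_trans (sumD m k); apply: ler_sum => i _.
  rewrite aE -powRN /lam expr2 -!NM; apply: ler_powR; first exact: freq_ge1.
  lra.
(* [nu ^ 2 * D] is the cost of dissipation and the extra 1 that of the flux through the truncation.
   [y0] gives [c * y0 >= 2] and [y0 >= 4 * C], hence [c * y0 ^ 2 >= 8 * C]. *)
pose c := (4 * D)^-1; pose C := nu ^+ 2 * D + 1; pose y0 := 4 * C + 2 / c.
have c0 : 0 < c by rewrite invr_gt0 mulr_gt0.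
have C0 : 0 < C by rewrite ltr_wpDl// mulr_ge0 ?sqr_ge0// ltW.
have y00 : 0 < y0 by rewrite addr_gt0// ?divr_gt0// mulr_gt0.
have cy0 : 2 <= c * y0.
  have -> : c * y0 = 4 * (c * C) + 2 by rewrite /y0; field; rewrite gt_eqF.
  by have := mulr_gt0 c0 C0; lra.
have Cy0 : 4 * C <= y0 by rewrite lerDl divr_ge0// ltW.
exists (fun n => if n == m then y0 / lam m else 0); split.
- by move=> n; case: ifP => // _; rewrite divr_ge0// ltW.
- by exists m.+1 => n mn; rewrite gtn_eqF.
move=> I u I01 [_ ueq u0] uge0; apply/eqP; apply: contraT => /HN_sup_coord[K K0 uK].
have {}ueq n : exists du, deriv_on I (u^~ n) du /\ forall t, t \in I ->
    du t = net_flux R N (u t) n - nu * N n `^ (2 * alpha) * u t n.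
  have [du [d1 _ d2]] := ueq n; exists du; split => // t tI.
  by have := d2 t tI; rewrite /net_flux; lra.
have /choice[du duP] := ueq.
(* [- e] dominates the exponents of the two terms of the flux through the
   truncation; this is where [alphac b < s] enters. *)
pose e := Num.min (2 * s - (1 + b * p)) ((b + 1) * s - (1 + p)).
(* Only [k] depends on [K]. The threshold makes each flux term at most one half, and the added 1
   covers [K = 0]. *)
have [||k Hk] := freq_small R N0 b N0gt1 b1 e (2 * (K ^+ 2 + 1))^-1.
- by rewrite lt_min !subr_gt0 p3.
- by rewrite invr_gt0 mulr_gt0// ltr_wpDl// sqr_ge0.
have {}Hk x : x <= - e -> N (m + k)%N `^ x * K ^+ 2 <= 2^-1.
  move=> xe; apply: (@le_trans _ _ ((2 * (K ^+ 2 + 1))^-1 * K ^+ 2)).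
    apply: ler_wpM2r; first exact: sqr_ge0.
    by apply: le_trans (Hk _ (leq_addl _ _)); apply: ler_powR => //; exact: freq_ge1.
  rewrite invfM -mulrA ler_piMr// ler_pdivrMl ?ltr_wpDl ?sqr_ge0//.
  by rewrite mulr1 lerDl.
pose L t := \sum_(i < k.+1) lam (m + i)%N * u t (m + i)%N.
pose dL t := \sum_(i < k.+1) lam (m + i)%N * du (m + i)%N t.
have LdL : deriv_on I L dL.
  apply: (deriv_on_lincomb R I (fun i => lam (m + i)%N) (fun i => u^~ (m + i)%N)
    (fun i => du (m + i)%N)) => n; by case: (duP (m + n)%N).
have L0 : L 0 = y0.
  have I0 : 0 \in I by apply: I01; rewrite /= in_itv /= lexx ler01.
  rewrite /L big_ord_recl [nat_of_ord _]/= (u0 I0) addn0 eqxx mulrC divfK ?gt_eqF//.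
  rewrite big1 ?addr0// => i _; rewrite (u0 I0) /bump /= gtn_eqF ?mulr0//.
  by rewrite -addn1 leq_add2l.
exfalso; apply: (@riccati_blowup R c C L dL); rewrite ?L0 ?(ltW C0)//.
- by apply: continuous_subspaceW I01 _; exact: deriv_on_within_continuous LdL.
- by move=> t; exact: deriv_on_is_derive LdL I01.
- move=> t t01; have t01' : t \in `[0, 1] by exact: subset_itv_oo_cc t01.
  have tI : t \in I by exact: I01.
  set v := u t; have v0 n : 0 <= v n by exact: uge0.
  have vK n : N n `^ s * v n <= K by have := uK t t01' n; rewrite ger0_norm.
  have bd1 : a (m + k)%N * v (m + k)%N ^+ 2 <= 2^-1.
    move: (vK (m + k)%N) Hk; move: (m + k)%N => j vj Hj.
    have -> : a j * v j ^+ 2 = N j `^ (1 + b * p - 2 * s) * (N j `^ s * v j) ^+ 2.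
      have -> : a j = N j `^ (1 + b * p - 2 * s) * (N j `^ s * N j `^ s).
        by rewrite aE -!NM; congr (_ `^ _); ring.
      by ring.
    have xe : 1 + b * p - 2 * s <= - e by rewrite lerNr opprB ge_min lexx.
    apply: le_trans (Hj _ xe); rewrite ler_wpM2l ?powR_ge0// ler_sqr ?nnegrE//.
    by rewrite mulr_ge0// powR_ge0.
  have bd2 : lam (m + k)%N * N (m + k)%N * v (m + k)%N * v (m + k).+1 <= 2^-1.
    move: (vK (m + k)%N) (vK (m + k).+1) Hk; move: (m + k)%N => j vj vj1 Hj.
    have -> : lam j * N j * v j * v j.+1 = N j `^ (1 + p - (b + 1) * s) *
        ((N j `^ s * v j) * (N j.+1 `^ s * v j.+1)).
      rewrite NS (_ : _ * (_ * _) = N j `^ (1 + p - (b + 1) * s) * N j `^ s *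
         N j `^ (b * s) * v j * v j.+1); last by ring.
      rewrite /lam {2}NE -!NM; congr (_ `^ _ * _ * _); ring.
    have xe : 1 + p - (b + 1) * s <= - e by rewrite lerNr opprB ge_min lexx orbT.
    apply: le_trans (Hj _ xe); rewrite ler_wpM2l ?powR_ge0// expr2.
    by rewrite ler_pM// mulr_ge0// powR_ge0.
  pose Q := \sum_(i < k.+1) a (m + i)%N * v (m + i)%N ^+ 2.
  pose F := \sum_(i < k.+1) lam (m + i)%N * net_flux R N v (m + i)%N.
  have flux : 2^-1 * Q + 4^-1 * (a (m + k)%N * v (m + k)%N ^+ 2) <=
      F + a (m + k)%N * v (m + k)%N ^+ 2
      + lam (m + k)%N * N (m + k)%N * v (m + k)%N * v (m + k).+1.
    exact: weighted_flux_ge.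
  pose X := \sum_(i < k.+1) lam (m + i)%N * N (m + i)%N `^ (2 * alpha) * v (m + i)%N.
  (* The free parameter [4 * nu] charges the dissipation [nu * X] to a quarter of [Q]. *)
  have drag : 4 * nu * X <= Q + (4 * nu) ^+ 2 / 4 * D.
    apply: le_trans (weighted_sum_le R N lam v m Ngt0 lamgt0 k.+1
      (fun n => lam n * N n `^ (2 * alpha)) (4 * nu)) _.
    by rewrite lerD2l ler_wpM2l ?divr_ge0 ?sqr_ge0// dragD.
  (* [2 * L t / D] is the optimal parameter: it yields [L t ^ 2 / D <= Q]. *)
  have mass : 2 * L t / D * L t <= Q + (2 * L t / D) ^+ 2 / 4 * D.
    apply: le_trans (weighted_sum_le R N lam v m Ngt0 lamgt0 k.+1 lam
      (2 * L t / D)) _.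
    by rewrite lerD2l ler_wpM2l ?divr_ge0 ?sqr_ge0// massD.
  have -> : dL t = F - nu * X.
    rewrite mulr_sumr -sumrB; apply: eq_bigr => i _.
    by rewrite (duP (m + i)%N).2// -/v; ring.
  have {}mass : 4 * (c * L t ^+ 2) <= Q.
    have cE : 4 * (c * L t ^+ 2) =
        2 * L t / D * L t - (2 * L t / D) ^+ 2 / 4 * D.
      by rewrite /c; field; rewrite gt_eqF.
    by rewrite cE lerBlDr.
  (* Balance: the transfer supplies half of [Q], dissipation takes a quarter, and the remaining
     quarter bounds [c * L t ^ 2]. *)
  have := mulr_ge0 (ltW (agt0 (m + k)%N)) (sqr_ge0 (v (m + k)%N)).
  rewrite /C; move: flux drag mass bd1 bd2; clearbody F X Q.
  move: (c * L t ^+ 2) (a _ * v _ ^+ 2) (lam _ * N _ * v _ * v _) => A1 A2 A3.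
  by clear; lra.
- by lra.
- by have := ler_wpM2r (ltW y00) cy0; rewrite -mulrA -expr2; lra.
Qed.

(** * Global solutions and the maximal smooth existence time *)

Theorem theorem4p1 (R : realType) (N0 b nu alpha : R)
    (hN0 : 1 < N0) (hb1 : 1 < b) (hb2 : b < 2) (hnu : 0 < nu)
    (halpha0 : 0 <= alpha) (halpha : alpha < alphac b)
    (s : R) (hs : alphac b < s) :
  exists (h : nat -> R) (TR : R),
    [/\ nonneg_seq h,
        finitely_supported h,
        0 < TR,
        forall u : R -> nat -> R,
          finite_energy_solution (freq N0 b) nu alpha h `[0, +oo[ u ->
          nonneg_on `[0, +oo[ u ->
          HN_sup (freq N0 b) s 0 TR u = +oo%E &
        (Tmax (freq N0 b) nu alpha h <= TR%:E)%E].
Proof.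
have [h [h0 hfin blowup]] :=
  norm_inflation_datum R N0 b nu alpha s hN0 hb1 hb2 hnu halpha0 halpha hs.
exists h, 1; split => //.
  by move=> u; apply: blowup => t; rewrite /= !in_itv /= andbT => /andP[].
(* A smooth solution living past time 1 would have bounded norm on the compact interval [[0, 1]],
   against the blow-up. *)
apply: ge_ereal_sup => _ [T [_ [u [usol u0 usmooth]]] <-].
rewrite lee_fin leNgt; apply/negP => T1.
have sub : `[0, 1] `<=` [set` `[(0 : R), T[].
  by move=> t; rewrite /= !in_itv /= => /andP[-> /le_lt_trans ->].
have s0 : 0 < s by apply: lt_trans hs; rewrite invr_gt0; lra.
by have := usmooth 0 1 sub s s0; rewrite (blowup _ u sub usol u0) ltxx.
Qed.
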